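(* Let $G$ be a finite cyclic group of order $n\geq 3$ and let $H\neq\{e\}$ be a subgroup of $G$. Then the generalized non-coprime graph $\Gamma_{G,H}$ is claw-free if and only if one of the following holds: (i) $H=G$ and $|G|=p_1^{\alpha_1}p_2^{\alpha_2}$ for some two distinct primes $p_1,p_2$ and non-negative integers $\alpha_1,\alpha_2$; (ii) $H\neq G$ and $G$ is isomorphic to either $\mathbb{Z}_4$ or $\mathbb{Z}_6$.
   Context: For a finite group $G$ with identity $e$ and a subgroup $H\neq\{e\}$ of $G$, the generalized non-coprime graph $\Gamma_{G,H}$ is the simple undirected graph with vertex set $G\setminus\{e\}$ in which two distinct vertices $a,b$ are adjacent if and only if $\gcd(|a|,|b|)\neq 1$ and ($a\in H$ or $b\in H$), where $|a|$ denotes the order of the element $a$. A graph is claw-free if it does not contain $K_{1,3}$ as an induced subgraph. *)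

(* Defs.v *)
From HB Require Import structures.
From mathcomp Require Import all_boot all_order all_algebra all_fingroup all_solvable.
Set Implicit Arguments.
Unset Strict Implicit.
Unset Printing Implicit Defensive.

Record sgraph := SGraph {
  vertex :> finType;
  adj : rel vertex;
  adj_sym : symmetric adj;
  adj_irrefl : irreflexive adj
}.

Section CompleteBipartite.
Variables m n : nat.

Definition Kmn_adj : rel ('I_m + 'I_n)%type := fun u v =>
  match u, v with
  | inl _, inr _ | inr _, inl _ => true
  | _, _ => false
  end.

Lemma Kmn_sym : symmetric Kmn_adj. Proof. by case=> ? []. Qed.
Lemma Kmn_irrefl : irreflexive Kmn_adj. Proof. by case. Qed.

Definition complete_bipartite : sgraph := SGraph Kmn_sym Kmn_irrefl.
End CompleteBipartite.

(* The image of f induces in X a subgraph isomorphic to F. *)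
Definition contains_induced (X F : sgraph) : Prop :=
  exists f : F -> X,
    injective f /\ forall u v : F, adj (f u) (f v) = adj u v.

Definition claw_free (X : sgraph) : Prop :=
  ~ contains_induced X (complete_bipartite 1 3).

Section GeneralizedNonCoprimeGraph.
Variables (gT : finGroupType) (G H : {group gT}).

Definition gnc_vertex : finType := {x : gT | x \in G^#%g}.

Definition gnc_adj : rel gnc_vertex := fun a b =>
  [&& a != b,
      gcdn #[val a]%g #[val b]%g != 1
    & (val a \in H) || (val b \in H)].

Lemma gnc_sym : symmetric gnc_adj.
Proof. by move=> a b; rewrite /gnc_adj eq_sym gcdnC orbC. Qed.

Lemma gnc_irrefl : irreflexive gnc_adj.
Proof. by move=> a; rewrite /gnc_adj eqxx. Qed.

Definition gnc_graph : sgraph := SGraph gnc_sym gnc_irrefl.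
End GeneralizedNonCoprimeGraph.

(* Main.v *)
Require Import Defs.
From HB Require Import structures.
From mathcomp Require Import all_boot all_order all_algebra all_fingroup all_solvable.
From mathcomp Require Import zify.
Set Implicit Arguments.
Unset Strict Implicit.
Unset Printing Implicit Defensive.

(** Two distinct vertices of the graph fail to be adjacent for one of two reasons: their
    orders are coprime, or neither lies in [H].  Each reason is the source of
    one kind of claw.

    When [H = G] only coprimality matters, so the leaves of a claw have pairwise
    coprime orders and hence use up three distinct primes dividing [#|G|].
    Conversely three such primes give a claw: its leaves are elements of these
    orders and its centre a generator of [G] ([claw_three_primes]).

    When [H] is proper, generators of [G] lie outside [H], so they are pairwise
    non-adjacent, while each is adjacent to every nontrivial element of [H].
    Three generators thus make a claw ([claw_generators]), and a cyclic group of
    order [n] has three generators [g], [g^-1], [g ^+ k] as soon as some [k]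
    strictly between 1 and [n - 1] is coprime to [n]; this happens for every
    [n >= 3] other than 3, 4 and 6 ([ex_third_unit]).  A group of order 3 has no
    proper nontrivial subgroup.  A group of order 4 has too few vertices for a
    claw, and in order 6 the leaves of a claw would be three distinct
    generators, of which there are only two ([card6_no_claw]). *)

(** * Claws as four-vertex configurations *)

(** The centre is distinct from the leaves because adjacency is irreflexive. *)
Lemma contains_clawP (X : sgraph) :
  contains_induced X (complete_bipartite 1 3) <->
  exists c x y z : X,
    [/\ uniq [:: x; y; z], all (adj c) [:: x; y; z]
      & pairwise (fun u v => ~~ adj u v) [:: x; y; z]].
Proof.
split=> [[f [inj_f adj_f]] | [c [x [y [z [Us Ac Nadj]]]]]].
  pose l k (lt_k : k < 3) : X := f (inr (Ordinal lt_k)).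
  exists (f (inl ord0)), (@l 0 isT), (@l 1 isT), (@l 2 isT).
  split; rewrite /l /= ?adj_f //.
  by rewrite !inE !(inj_eq inj_f).
pose f (u : complete_bipartite 1 3) : X :=
  match u with inl _ => c | inr i => nth c [:: x; y; z] i end.
have adj_cl (i : 'I_3) : adj c (nth c [:: x; y; z] i).
  by apply: (allP Ac); apply: mem_nth; case: i.
have nadj_l (i j : 'I_3) :
    adj (nth c [:: x; y; z] i) (nth c [:: x; y; z] j) = false.
  move: Nadj => /=; rewrite !andbT => /andP[/andP[/negbTE xy /negbTE xz] /negbTE yz].
  by case: i => [[|[|[|]]] // ?]; case: j => [[|[|[|]]] // ?] /=;
    rewrite ?adj_irrefl ?xy ?xz ?yz // adj_sym.
exists f; split=> [[i|i] [j|j] /= Efij | [i|i] [j|j] //=].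
- by rewrite (ord1 i) (ord1 j).
- by have := adj_cl j; rewrite -Efij adj_irrefl.
- by have := adj_cl i; rewrite Efij adj_irrefl.
- congr inr; apply/val_inj/eqP.
  by rewrite -(nth_uniq c _ _ Us) ?Efij //; [case: (i) | case: (j)].
- exact: adj_irrefl.
- by have := adj_cl j.
- by have := adj_cl i; rewrite adj_sym.
Qed.

Section Claws.
Context {gT : finGroupType}.
Implicit Types G H : {group gT}.

(** The adjacency of the graph, on group elements rather than on the subtype of
    nontrivial elements of [G]. *)
Definition ncadj H : rel gT := fun a b =>
  [&& a != b, gcdn #[a]%g #[b]%g != 1 & (a \in H) || (b \in H)].

Definition nc_claw G H (c x y z : gT) :=
  [/\ all (mem G^#%g) [:: c; x; y; z], uniq [:: x; y; z],
      all (ncadj H c) [:: x; y; z]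
    & pairwise (fun u v => ~~ ncadj H u v) [:: x; y; z]].

Lemma claw_freeP G H :
  claw_free (gnc_graph G H) <-> forall c x y z, ~ nc_claw G H c x y z.
Proof.
split=> [cf c x y z [/= /and5P[Gc Gx Gy Gz _] U A N] | nc].
  apply/cf/contains_clawP.
  by exists (Sub c Gc), (Sub x Gx), (Sub y Gy), (Sub z Gz).
case/contains_clawP=> -[c Gc] [[x Gx] [[y Gy] [[z Gz] [U A N]]]].
by apply: (nc c x y z); split; rewrite //= Gc Gx Gy Gz.
Qed.

(** * The case where H is the whole group *)

Lemma claw_three_primes G p q r :
    cyclic G -> p \in primes #|G| -> q \in primes #|G| -> r \in primes #|G| ->
  uniq [:: p; q; r] -> exists c x y z, nc_claw G G c x y z.
Proof.
case/cyclicP=> g defG Pp Pq Pr; rewrite /= !inE andbT negb_or.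
case/andP=> /andP[npq npr] nqr.
pose x s := (g ^+ (#|G| %/ s))%g.
have Gg : g \in G by rewrite defG cycle_id.
have og : #[g]%g = #|G| by rewrite defG.
have ox s : s \in primes #|G| -> #[x s]%g = s.
  rewrite mem_primes => /and3P[pr_s G_gt0 sG].
  rewrite orderXdiv og ?divnA ?mulKn ?dvdn_div //.
have Gx s : s \in primes #|G| -> x s \in (G^#)%g.
  move=> Ps; rewrite !inE groupX // andbT -order_eq1 ox //.
  by move: Ps; rewrite mem_primes => /andP[/prime_gt1]; case: (s) => [|[]].
have ncop s : s \in primes #|G| -> gcdn #[g]%g #[x s]%g != 1.
  move=> Ps; rewrite ox // og; move: Ps; rewrite mem_primes.
  by case/and3P=> /prime_gt1 s1 _ /gcdn_idPr ->; rewrite neq_ltn s1 orbT.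
have cop s t : s \in primes #|G| -> t \in primes #|G| -> s != t ->
    gcdn #[x s]%g #[x t]%g = 1.
  move=> Ps Pt nst; rewrite !ox //; apply/eqP; rewrite -/(coprime s t).
  move: Ps Pt; rewrite !mem_primes => /andP[prs _] /andP[prt _].
  by rewrite prime_coprime // dvdn_prime2.
have neqx s t : s \in primes #|G| -> t \in primes #|G| -> s != t -> x s != x t.
  by move=> Ps Pt; apply: contraNneq => /(congr1 order); rewrite !ox // => ->.
(* A second prime [t] dividing [#|G|] prevents [g] from having prime order [s]. *)
have neqg s t : s \in primes #|G| -> t \in primes #|G| -> s != t -> g != x s.
  move=> Ps Pt; apply: contraNneq => /(congr1 order); rewrite ox // og => Gs.
  move: Ps Pt; rewrite Gs !mem_primes => /andP[prs _] /and3P[prt _].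
  by rewrite dvdn_prime2 // eq_sym.
exists g, (x p), (x q), (x r); split.
- rewrite /= !Gx // !inE Gg -order_eq1 og !andbT.
  by apply: contraTneq Pp => ->.
- by rewrite /= !inE negb_or !neqx.
- rewrite /= /ncadj Gg !ncop // (neqg p q) // (neqg q r) // (neqg r q) //.
  by rewrite eq_sym.
- by rewrite /= /ncadj !cop ?andbF.
Qed.

(** The least prime factors of the orders of the leaves are distinct elements
    of [{p1, p2}]. *)
Lemma two_primes_no_claw G p1 p2 a1 a2 c x y z :
    prime p1 -> prime p2 -> #|G| = p1 ^ a1 * p2 ^ a2 ->
  ~ nc_claw G G c x y z.
Proof.
move=> pr1 pr2 oG [/= /and5P[_ Gx Gy Gz _] U _ N].
have pP u : u \in (G^#)%g -> pdiv #[u]%g \in [:: p1; p2].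
  rewrite !inE -order_eq1 => /andP[u1 Gu].
  have pr_u : prime (pdiv #[u]%g).
    by apply: pdiv_prime; rewrite ltn_neqAle eq_sym u1 order_gt0.
  have: pdiv #[u]%g %| #|G| := dvdn_trans (pdiv_dvd _) (order_dvdG Gu).
  rewrite oG Euclid_dvdM // !Euclid_dvdX // !dvdn_prime2 //.
  by case/orP=> /andP[-> _]; rewrite ?orbT.
have neq u v : u \in (G^#)%g -> v \in (G^#)%g -> u != v -> ~~ ncadj G u v ->
    pdiv #[u]%g != pdiv #[v]%g.
  rewrite !inE -!order_eq1 /ncadj => /andP[u1 Gu] /andP[v1 Gv] ->.
  rewrite Gu andbT /= negbK => /eqP cop; apply: contraNneq u1 => Epd.
  have: pdiv #[u]%g %| gcdn #[u]%g #[v]%g by rewrite dvdn_gcd {2}Epd !pdiv_dvd.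
  rewrite cop dvdn1 => /eqP pd1; rewrite eqn_leq order_gt0 andbT leqNgt.
  by apply/negP=> /pdiv_prime; rewrite pd1.
have: size [:: pdiv #[x]%g; pdiv #[y]%g; pdiv #[z]%g] <= size [:: p1; p2].
  apply: uniq_leq_size; last first.
    by apply/(allP (a := [in [:: p1; p2]])); rewrite /= !pP.
  move: U N; rewrite /= !inE !negb_or !andbT.
  by case/andP=> /andP[xy xz] yz /andP[/andP[nxy nxz] nyz]; rewrite !neq.
by [].
Qed.

End Claws.

(** An absent prime enters with exponent 0, so any prime can stand in for it. *)
Lemma few_primes n :
    0 < n -> size (primes n) <= 2 ->
  exists p1 p2 a1 a2,
    [/\ prime p1, prime p2, p1 <> p2 & n = p1 ^ a1 * p2 ^ a2].
Proof.
move=> n_gt0; have := prod_prime_decomp n_gt0; rewrite prime_decompE big_map.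
have := primes_uniq n; have: all prime (primes n).
  by apply/allP=> p; rewrite mem_primes => /andP[].
case: (primes n) => [|p [|q [|//]]] /=; rewrite ?inE ?andbT.
- by rewrite big_nil => _ _ -> _; exists 2, 3, 0, 0.
- rewrite big_seq1 => pr_p _ {1}-> _.
  by exists p, (if p == 2 then 3 else 2), (logn p n), 0; split;
    rewrite ?muln1 //; case: (p =P 2) => // ->.
- rewrite big_cons big_seq1 => /andP[pr_p pr_q] /eqP npq {1}-> _.
  by exists p, q, (logn p n), (logn q n).
Qed.

(** * The case of a proper subgroup *)

(** For odd [n] take 2; for [n = 2m] take the largest odd number below [m]. *)
Lemma ex_third_unit n :
    3 < n -> n != 4 -> n != 6 -> exists k, [/\ 1 < k, k < n.-1 & coprime n k].
Proof.
move=> n3 n4 n6; have En := odd_double_half n.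
case odd_n: (odd n) En => /= En.
  by exists 2; rewrite coprimen2 odd_n; split=> //; lia.
set m := n./2 in En; have m3 : 3 < m by lia.
rewrite -En -muln2.
case odd_m: (odd m).
  exists (m - 2); have om2: odd (m - 2) by rewrite oddB ?odd_m //; lia.
  split; [lia | lia |]; rewrite coprimeMl coprime2n om2 andbT.
  have Em : m = m - 2 + 2 by lia.
  by rewrite {1}Em /coprime gcdnC gcdnDl -/(coprime _ 2) coprimen2.
exists m.-1; split; [lia | lia |].
rewrite coprimeMl coprime2n -[X in odd X]subn1 oddB ?odd_m; last by lia.
by rewrite andbT coprimenP; lia.
Qed.

Section ProperSubgroup.
Context {gT : finGroupType}.
Implicit Types G H : {group gT}.

Lemma claw_generators G H x y z :
    H \proper G -> H :!=: 1%g -> uniq [:: x; y; z] ->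
    all (generator G) [:: x; y; z] ->
  exists c, nc_claw G H c x y z.
Proof.
case/properP=> sHG [u Gu nHu] ntH U gen.
have [h Hh nt_h] := trivgPn _ ntH; exists h.
have Gh := subsetP sHG h Hh.
have gP w : generator G w -> [/\ w \notin H, w \in G & #[w]%g = #|G|].
  move=> gw; have defG : G = <[w]>%g :> {set gT} := eqP gw.
  split; [|by rewrite defG cycle_id | by rewrite orderE -defG].
  by apply: contra nHu => Hw; move: u Gu; apply/subsetP; rewrite defG cycle_subG.
have {}gP w : generator G w -> [/\ w \notin H, w \in (G^#)%g & ncadj H h w].
  move=> gw; have [nHw Gw ow] := gP w gw; split=> //.
    by rewrite !inE Gw andbT; apply: contraNneq nHw => ->.
  rewrite /ncadj Hh andbT ow (gcdn_idPl _) ?order_dvdG // order_eq1 nt_h andbT.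
  by apply: contraNneq nHw => <-.
move: gen => /= /and4P[/gP[Hx Gx Ax] /gP[Hy Gy Ay] /gP[Hz Gz Az] _].
split=> //=; first by rewrite Gx Gy Gz !inE Gh nt_h.
  by rewrite Ax Ay Az.
by rewrite /ncadj (negbTE Hx) (negbTE Hy) (negbTE Hz) !andbF.
Qed.

Lemma cyclic_three_generators G :
    cyclic G -> 3 < #|G| -> #|G| != 4 -> #|G| != 6 ->
  exists x y z, uniq [:: x; y; z] /\ all (generator G) [:: x; y; z].
Proof.
case/cyclicP=> g defG G3 G4 G6; have og : #[g]%g = #|G| by rewrite defG.
have [k [k1 kn cop]] := ex_third_unit G3 G4 G6.
have gen j : coprime #|G| j -> generator G (g ^+ j)%g.
  by rewrite -og defG generator_coprime.
exists (g ^+ 1)%g, (g ^+ k)%g, (g ^+ #|G|.-1)%g; split; last first.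
  by rewrite /= !gen ?coprimen1 ?coprimenP // ltnW // ltnW // ltnW.
rewrite /= !inE !eq_expg_mod_order og.
by move: #|G| G3 kn => n n3 kn; rewrite !modn_small; lia.
Qed.

Lemma card4_no_claw G H c x y z : #|G| = 4 -> ~ nc_claw G H c x y z.
Proof.
move=> oG [sG U A _].
have Uc : uniq [:: c; x; y; z].
  rewrite cons_uniq U andbT; apply/negP=> /(allP A).
  by rewrite /ncadj eqxx.
have: size [:: c; x; y; z] <= size (enum (G^#)%g).
  by apply: uniq_leq_size => // u u_s; rewrite mem_enum; apply: (allP sG).
by rewrite -cardE; have := cardsD1 1%g G; rewrite group1 oG add1n => /succn_inj <-.
Qed.

(** A subgroup of order 2 or 3 is too small to hold all the leaves, so the
    centre lies in [H] and has prime order [#|H|].  Hence [#|H|] divides the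
    order of every leaf; a leaf in [H] would then be adjacent to the others, so
    the leaves lie outside [H], and by uniqueness of subgroups of a given order
    in a cyclic group the leaves must have order 6. *)
Lemma card6_no_claw G H c x y z :
    cyclic G -> #|G| = 6 -> H \proper G -> H :!=: 1%g ->
  ~ nc_claw G H c x y z.
Proof.
move=> cycG oG pHG ntH [sG U A N]; have sHG := proper_sub pHG.
have oH : #|H| = 2 \/ #|H| = 3.
  have := cardSg sHG; have := proper_card pHG; have := cardG_gt1 H.
  by rewrite ntH oG; case: #|H| => [|[|[|[|[|[|]]]]]] //; auto.
have pr_H : prime #|H| by case: oH => ->.
have [d [oGd d_pr]] : exists d, #|G| = #|H| * d /\ prime d.
  by rewrite oG; case: oH => ->; [exists 3 | exists 2].
have oHP u : u \in H -> u != 1%g -> #[u]%g = #|H|.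
  move=> Hu nt_u; have /orP[] := (primeP pr_H).2 _ (order_dvdG Hu).
    by rewrite order_eq1 (negbTE nt_u).
  by move/eqP.
have Hc : c \in H.
  apply: contraT => nHc.
  have: size [:: 1%g; x; y; z] <= size (enum H).
    apply: uniq_leq_size => [|u].
      rewrite cons_uniq U andbT; apply/negP=> s1.
      have /(allP sG) : 1%g \in c :: [:: x; y; z] by rewrite in_cons s1 orbT.
      by rewrite !inE eqxx.
    rewrite in_cons mem_enum => /predU1P[-> // | /(allP A)].
    by rewrite /ncadj (negbTE nHc) => /and3P[].
  by rewrite -cardE; case: oH => ->.
have oc : #[c]%g = #|H|.
  by apply: oHP => //; have /andP[] := sG; rewrite !inE => /andP[].
have dvdH u : u \in [:: x; y; z] -> #|H| %| #[u]%g.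
  by move/(allP A); rewrite /ncadj oc -/(coprime _ _) prime_coprime // negbK =>
    /and3P[].
have nHl u v : u \in [:: x; y; z] -> v \in [:: x; y; z] -> u != v ->
    ~~ ncadj H u v -> (u \notin H) && (v \notin H).
  move=> su sv nuv; rewrite /ncadj nuv /= negb_and negb_or => /orP[|//].
  rewrite negbK => /eqP g1; have: #|H| %| gcdn #[u]%g #[v]%g.
    by rewrite dvdn_gcd !dvdH.
  by rewrite g1 dvdn1 => /eqP H1; rewrite H1 in pr_H.
have gen u : u \in [:: x; y; z] -> u \in [set v | generator G v].
  move=> su; rewrite inE.
  have Gu : u \in G.
    have /(allP sG) : u \in c :: [:: x; y; z] by rewrite in_cons su orbT.
    by case/setD1P.
  have nHu : u \notin H.
    have [sx sy sz] : [/\ x \in [:: x; y; z], y \in [:: x; y; z] & z \in [:: x; y; z]].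
      by rewrite !inE !eqxx !orbT.
    move: U N; rewrite /= !inE !negb_or !andbT.
    case/andP=> /andP[xy xz] _ /andP[/andP[nxy nxz] _].
    have /andP[nx ny] := nHl x y sx sy xy nxy.
    have /andP[_ nz] := nHl x z sx sz xz nxz.
    by move: su; rewrite !inE => /or3P[] /eqP->.
  have Gou := order_dvdG Gu; have /dvdnP[k ok] := dvdH u su.
  have kd : k %| d by rewrite -(@dvdn_pmul2l #|H|) // -oGd mulnC -ok.
  have ou : #[u]%g = #|G|.
    have /orP[/eqP k1 | /eqP kE] := (primeP d_pr).2 k kd; last by rewrite ok kE mulnC -oGd.
    case/negP: nHu; suff /eqP <- : <[u]>%g == H :> {set gT} by apply: cycle_id.
    by rewrite (eq_subG_cyclic cycG) ?cycle_subG // -orderE ok k1 mul1n.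
  by rewrite /generator eq_sym eqEcard cycle_subG Gu -orderE ou /=.
have two_gen : #|[set v | generator G v]| = 2.
  have [g defG] := cyclicP cycG.
  by rewrite defG -totient_gen orderE -defG oG.
have: size [:: x; y; z] <= size (enum [set v | generator G v]).
  by apply: uniq_leq_size => // u su; rewrite mem_enum gen.
by rewrite -cardE two_gen.
Qed.

End ProperSubgroup.

Theorem theorem2p11 (gT : finGroupType) (G H : {group gT})
    (cycG : cyclic G) (leG : 3 <= #|G|)
    (sHG : H \subset G) (ntH : H <> 1%G) :
  claw_free (gnc_graph G H) <->
  ((H = G /\
    exists p1 p2 a1 a2 : nat,
      [/\ prime p1, prime p2, p1 <> p2 & #|G| = p1 ^ a1 * p2 ^ a2]) \/
   (H <> G /\ (G \isog [set: 'Z_4] \/ G \isog [set: 'Z_6]))).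
Proof.
have isoZ n : 1 < n -> G \isog [set: 'Z_n] <-> #|G| = n.
  move=> n1; have cycZ : cyclic [set: 'Z_n] by rewrite Zp_cycle cycle_cyclic.
  have oZ : #|[set: 'Z_n]| = n by rewrite cardsT card_ord Zp_cast.
  by rewrite isog_cyclic_card // cycZ oZ eq_sym; split=> /eqP.
have nt_H : H :!=: 1%g by apply/eqP=> /val_inj.
rewrite claw_freeP !isoZ //; split=> [nc | [[-> [p1 [p2 [a1 [a2 []]]]]] | [nHG oG]]].
- case: (H =P G) nc => [-> | nHG] nc; [left | right]; split=> //.
    apply: few_primes => //; rewrite leqNgt; apply/negP.
    have := primes_uniq #|G|; have: {subset primes #|G| <= primes #|G|} by [].
    case: {1 3 4}(primes #|G|) => [|p [|q [|r s]]] // sub /= U _.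
    have [| | | | c [x [y [z cl]]]] := @claw_three_primes _ G p q r cycG;
      rewrite ?sub ?inE ?eqxx ?orbT //; last exact: nc cl.
    by move: U; rewrite /= !inE !negb_or => /and3P[/and3P[-> -> _] /andP[-> _]].
  have pHG : H \proper G.
    by rewrite properEneq sHG andbT; apply/eqP=> /val_inj.
  have G3 : 3 < #|G|.
    rewrite ltn_neqAle leG andbT; apply/eqP=> oG.
    have := cardSg sHG; have := proper_card pHG; have := cardG_gt1 H.
    by rewrite nt_H -oG; case: #|H| => [|[|[|[|]]]].
  have [? | G4] := eqVneq #|G| 4; [by left | have [? | G6] := eqVneq #|G| 6; first by right].
  have [x [y [z [U gen]]]] := cyclic_three_generators cycG G3 G4 G6.
  by have [c /nc] := claw_generators pHG nt_H U gen.
- by move=> pr1 pr2 _ oG c x y z; apply: two_primes_no_claw oG.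
- have pHG : H \proper G.
    by rewrite properEneq sHG andbT; apply/eqP=> /val_inj.
  by move=> c x y z; case: oG => oG; [apply: card4_no_claw | apply: card6_no_claw].
Qed.
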